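(* Consider the complex 3-dimensional Novikov algebras $D_1$, $D_2(\alpha)$ $(\alpha\in\mathbb{C})$ and $A_1,\dots,A_{12}$ given by the products listed in the context. For $1\le j\le12$: \begin{itemize} \item $A_j$ lies in $\partial O(D_1)$ if and only if $j\in\{1,5\}$; \item for every $\alpha\in\mathbb{C}$, $A_j$ lies in $\partial O(D_2(\alpha))$ if and only if $j\in\{1,5\}$. \end{itemize}
   Context: A Novikov algebra over $\mathbb{C}$ is a complex vector space with a bilinear product satisfying $(x\cdot y)\cdot z-x\cdot(y\cdot z)=(y\cdot x)\cdot z-y\cdot(x\cdot z)$ and $(x\cdot y)\cdot z=(x\cdot z)\cdot y$ for all $x,y,z$. Fix a 3-dimensional complex vector space $V$ with basis $(e_1,e_2,e_3)$. The set of Novikov products on $V$, identified with their structure constants in $\mathbb{C}^{27}$, is an affine algebraic set, on which $GL_3(\mathbb{C})$ acts by $(g\circ\mu)(x,y)=g(\mu(g^{-1}x,g^{-1}y))$. For a 3-dimensional Novikov algebra $A$, $O(A)$ is the orbit of a structure representing $A$, $\overline{O(A)}$ its Zariski closure, and $\partial O(A)=\overline{O(A)}\setminus O(A)$; ''$B$ lies in $\partial O(A)$'' means that a structure representing $B$ lies in $\partial O(A)$. The algebras (basis $e_1,e_2,e_3$; products of basis vectors not listed are zero): $D_1$: $e_1e_1=-e_1+e_3$, $e_1e_3=e_2$, $e_2e_1=-e_2$, $e_3e_1=-e_3$. $D_2(\alpha)$: $e_1e_1=\alpha e_1$, $e_1e_2=(\alpha+1)e_2$, $e_1e_3=e_2+(\alpha+1)e_3$,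 $e_2e_1=\alpha e_2$, $e_3e_1=\alpha e_3$. $A_1$: all products zero. $A_2$: $e_3e_3=e_3$. $A_3$: $e_2e_2=e_2$, $e_3e_3=e_3$. $A_4$: $e_1e_1=e_1$, $e_2e_2=e_2$, $e_3e_3=e_3$. $A_5$: $e_2e_2=e_1$. $A_6$: $e_2e_2=e_1$, $e_3e_3=e_3$. $A_7$: $e_1e_2=e_1$, $e_2e_1=e_1$, $e_2e_2=e_2$. $A_8$: $e_1e_2=e_1$, $e_2e_1=e_1$, $e_2e_2=e_2$, $e_3e_3=e_3$. $A_9$: $e_2e_3=e_1$, $e_3e_2=e_1$. $A_{10}$: $e_2e_3=e_1$, $e_3e_2=e_1$, $e_3e_3=e_2$. $A_{11}$: $e_1e_3=e_1$, $e_2e_3=e_2$, $e_3e_1=e_1$, $e_3e_2=e_2$, $e_3e_3=e_3$. $A_{12}$: $e_1e_3=e_1$, $e_2e_2=e_1$, $e_2e_3=e_2$, $e_3e_1=e_1$, $e_3e_2=e_2$, $e_3e_3=e_3$. *)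

(* Defs.v *)
From HB Require Import structures.
From mathcomp Require Import all_boot all_order all_algebra.
From mathcomp Require Import boolp classical_sets reals.
From mathcomp.real_closed Require Import complex.
From mathcomp.multinomials Require Import mpoly.
From mathcomp Require Import ring.

Set Implicit Arguments.
Unset Strict Implicit.
Unset Printing Implicit Defensive.

Import GRing.Theory.
Local Open Scope classical_set_scope.
Local Open Scope ring_scope.

Section Structures.
Variable R : realType.

Local Notation C := (complex R).
Local Notation V := 'cV[C]_3.

(* A point of C^27: [c (i, j, k)] is the coefficient of the (k+1)-st basis
   vector in the product of the (i+1)-st and the (j+1)-st ones. *)
Definition structure := {ffun 'I_3 * 'I_3 * 'I_3 -> C}.

Definition mul (c : structure) (x y : V) : V :=
  \col_k \sum_i \sum_j c (i, j, k) * x i 0 * y j 0.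

Definition novikov : set structure := [set c |
  (forall x y z : V,
     mul c (mul c x y) z - mul c x (mul c y z) =
     mul c (mul c y x) z - mul c y (mul c x z)) /\
  (forall x y z : V, mul c (mul c x y) z = mul c (mul c x z) y)].

(* Polynomial functions on C^27 are taken in the coordinates enumerated by
   [enum_val : 'I_#|'I_3 * 'I_3 * 'I_3| -> 'I_3 * 'I_3 * 'I_3]. *)
Definition zeros (I : set {mpoly C[#|{: 'I_3 * 'I_3 * 'I_3}|]}) :
    set structure :=
  [set c | forall p, I p -> p.@[fun m => c (enum_val m)] = 0].

Definition zariski_closed : set (set structure) :=
  [set Z | exists I, Z = zeros I].

Definition zariski_closure (X : set structure) : set structure :=
  smallest zariski_closed X.

Definition orbit (c : structure) : set structure :=
  [set d | exists2 g : 'M[C]_3, g \in unitmx &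
     forall x y : V, mul d x y = g *m mul c (invmx g *m x) (invmx g *m y)].

(* The closure may be taken in C^27: [novikov] is Zariski closed and contains
   the orbits of its points. *)
Definition orbit_boundary (c : structure) : set structure :=
  zariski_closure (orbit c) `\` orbit c.

(* The structures representing the algebra of [b] are those in [orbit b]. *)
Definition lies_in_boundary (b a : structure) : Prop :=
  exists2 d, orbit b d & orbit_boundary a d.

(* [e 1], [e 2], [e 3] is the standard basis. *)
Definition e (n : nat) : V := \col_i (i.+1 == n)%:R.

Definition of_products (f : nat -> nat -> V) : structure :=
  [ffun t : 'I_3 * 'I_3 * 'I_3 => f t.1.1.+1 t.1.2.+1 t.2 0].

Definition D1 : structure := of_products (fun i j =>
  match i, j with
  | 1%N, 1%N => - e 1 + e 3
  | 1%N, 3%N => e 2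
  | 2%N, 1%N => - e 2
  | 3%N, 1%N => - e 3
  | _, _ => 0
  end).

Definition D2 (alpha : C) : structure := of_products (fun i j =>
  match i, j with
  | 1%N, 1%N => alpha *: e 1
  | 1%N, 2%N => (alpha + 1) *: e 2
  | 1%N, 3%N => e 2 + (alpha + 1) *: e 3
  | 2%N, 1%N => alpha *: e 2
  | 3%N, 1%N => alpha *: e 3
  | _, _ => 0
  end).

Definition A1 : structure := of_products (fun _ _ => 0).

Definition A2 : structure := of_products (fun i j =>
  match i, j with
  | 3%N, 3%N => e 3
  | _, _ => 0
  end).

Definition A3 : structure := of_products (fun i j =>
  match i, j with
  | 2%N, 2%N => e 2
  | 3%N, 3%N => e 3
  | _, _ => 0
  end).

Definition A4 : structure := of_products (fun i j =>
  match i, j with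
  | 1%N, 1%N => e 1
  | 2%N, 2%N => e 2
  | 3%N, 3%N => e 3
  | _, _ => 0
  end).

Definition A5 : structure := of_products (fun i j =>
  match i, j with
  | 2%N, 2%N => e 1
  | _, _ => 0
  end).

Definition A6 : structure := of_products (fun i j =>
  match i, j with
  | 2%N, 2%N => e 1
  | 3%N, 3%N => e 3
  | _, _ => 0
  end).

Definition A7 : structure := of_products (fun i j =>
  match i, j with
  | 1%N, 2%N => e 1
  | 2%N, 1%N => e 1
  | 2%N, 2%N => e 2
  | _, _ => 0
  end).

Definition A8 : structure := of_products (fun i j =>
  match i, j with
  | 1%N, 2%N => e 1
  | 2%N, 1%N => e 1
  | 2%N, 2%N => e 2
  | 3%N, 3%N => e 3
  | _, _ => 0
  end).

Definition A9 : structure := of_products (fun i j =>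
  match i, j with
  | 2%N, 3%N => e 1
  | 3%N, 2%N => e 1
  | _, _ => 0
  end).

Definition A10 : structure := of_products (fun i j =>
  match i, j with
  | 2%N, 3%N => e 1
  | 3%N, 2%N => e 1
  | 3%N, 3%N => e 2
  | _, _ => 0
  end).

Definition A11 : structure := of_products (fun i j =>
  match i, j with
  | 1%N, 3%N => e 1
  | 2%N, 3%N => e 2
  | 3%N, 1%N => e 1
  | 3%N, 2%N => e 2
  | 3%N, 3%N => e 3
  | _, _ => 0
  end).

Definition A12 : structure := of_products (fun i j =>
  match i, j with
  | 1%N, 3%N => e 1
  | 2%N, 2%N => e 1
  | 2%N, 3%N => e 2
  | 3%N, 1%N => e 1
  | 3%N, 2%N => e 2
  | 3%N, 3%N => e 3
  | _, _ => 0
  end).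

(* Only the indices from 1 to 12 are meaningful. *)
Definition A (j : nat) : structure :=
  match j with
  | 1%N => A1
  | 2%N => A2
  | 3%N => A3
  | 4%N => A4
  | 5%N => A5
  | 6%N => A6
  | 7%N => A7
  | 8%N => A8
  | 9%N => A9
  | 10%N => A10
  | 11%N => A11
  | 12%N => A12
  | _ => A1
  end.

Definition vec3 (a b c : C) : V := \col_k nth 0 [:: a; b; c] k.

Lemma vec3P (x : V) : exists a b c, x = vec3 a b c.
Proof.
exists (x 0 0), (x 1 0), (x (1 + 1) 0).
by apply/colP; case=> [[|[|[|//]]] ?]; rewrite !mxE /=; congr (x _ 0);
  apply/val_inj.
Qed.

Lemma vec3B a b c a' b' c' :
  vec3 a b c - vec3 a' b' c' = vec3 (a - a') (b - b') (c - c').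
Proof. by apply/colP; case=> [[|[|[|//]]] ?]; rewrite !mxE. Qed.

Lemma mul_vec3 (f : nat -> nat -> V) a b c a' b' c' :
  let g (k : 'I_3) : C :=
    f 1%N 1%N k 0 * a * a' + f 1%N 2%N k 0 * a * b' + f 1%N 3%N k 0 * a * c' +
    (f 2%N 1%N k 0 * b * a' + f 2%N 2%N k 0 * b * b' + f 2%N 3%N k 0 * b * c') +
    (f 3%N 1%N k 0 * c * a' + f 3%N 2%N k 0 * c * b' + f 3%N 3%N k 0 * c * c')
  in mul (of_products f) (vec3 a b c) (vec3 a' b' c') =
     vec3 (g ord0) (g (lift ord0 ord0)) (g (lift ord0 (lift ord0 ord0))).
Proof.
move=> g; apply/colP => k; rewrite mxE.
transitivity (g k).
  by rewrite !big_ord_recl !big_ord0 !ffunE !mxE /= !addr0 /g !addrA.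
by rewrite mxE; case: k => [[|[|[|//]]] ?] /=; congr g; apply/val_inj.
Qed.

Definition simpE := (mul0r, mulr0, add0r, addr0, mul1r, mulr1, mulr0n, mulr1n, oppr0,
  mulNr).

Lemma novikov_vec3 c (m1 m2 m3 : C -> C -> C -> C -> C -> C -> C) :
  let m x y :=
    let: (x1, x2, x3) := x in let: (y1, y2, y3) := y in
    (m1 x1 x2 x3 y1 y2 y3, m2 x1 x2 x3 y1 y2 y3, m3 x1 x2 x3 y1 y2 y3) in
  let sub x y :=
    let: (x1, x2, x3) := x in let: (y1, y2, y3) := y in
    (x1 - y1, x2 - y2, x3 - y3) : C * C * C in
  (forall x1 x2 x3 y1 y2 y3, mul c (vec3 x1 x2 x3) (vec3 y1 y2 y3) =
     vec3 (m1 x1 x2 x3 y1 y2 y3) (m2 x1 x2 x3 y1 y2 y3)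
       (m3 x1 x2 x3 y1 y2 y3)) ->
  (forall x1 x2 x3 y1 y2 y3 z1 z2 z3,
     let x := (x1, x2, x3) in
     let y := (y1, y2, y3) in
     let z := (z1, z2, z3) in
     sub (m (m x y) z) (m x (m y z)) = sub (m (m y x) z) (m y (m x z)) /\
     m (m x y) z = m (m x z) y) ->
  novikov c.
Proof.
move=> m sub cE H; split=> x y z;
  have [x1 [x2 [x3 ->]]] := vec3P x; have [y1 [y2 [y3 ->]]] := vec3P y;
  have [z1 [z2 [z3 ->]]] := vec3P z;
  have [/= [H1 H2 H3] [H4 H5 H6]] := H x1 x2 x3 y1 y2 y3 z1 z2 z3.
- by rewrite !cE !vec3B H1 H2 H3.
- by rewrite !cE H4 H5 H6.
Qed.

Ltac novikov_tac :=
  eapply novikov_vec3;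
  [ move=> ? ? ? ? ? ?; rewrite mul_vec3 /= /e !mxE /= ?simpE; reflexivity
  | move=> ? ? ? ? ? ? ? ? ? /=; split; congr (_, _, _); ring ].

Lemma novikov_D1 : novikov D1.
Proof. novikov_tac. Qed.

Lemma novikov_D2 alpha : novikov (D2 alpha).
Proof. novikov_tac. Qed.

Lemma novikov_A j : novikov (A j).
Proof. case: j => [|[|[|[|[|[|[|[|[|[|[|[|[|?]]]]]]]]]]]]]; novikov_tac. Qed.

End Structures.

(* Main.v *)
From mathcomp Require Import all_boot all_order all_algebra.
From mathcomp Require Import boolp classical_sets reals.
From mathcomp.real_closed Require Import complex.
From mathcomp.multinomials Require Import mpoly.
From mathcomp Require Import ring.
Require Import Defs.

(** Both D_1 and D_2(alpha) have products of the shape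
      x y = a l(y) x + l(x) N y    with l N = 0 and tr N = 2 (a + 1),
    for a linear form l and an endomorphism N: take a = alpha for D_2(alpha),
    and a = -1 for D_1. All the structures in [Dfamily a eps], which contains
    them both, have the same commutative degenerations among the A_j.

    To bound the closure of the orbit from above, write L_x and R_y for the left
    and right multiplications. Here R_y = a l(y) + (N y) l, so tr R_y = 3 a l(y),
    and L_x = a x l + l(x) N, so tr L_x = (3 a + 2) l(x). Hence
      (3 a + 2) tr R_y = 3 a tr L_y,
    and S(x, y) = 3 x y - tr(R_y) x equals 3 l(x) N y, so that, as 3 x 3 matrices,
      S(x, y) S(x', y')^T = S(x', y) S(x, y')^T.
    These two conditions ([pinched]) are polynomial in the structure constants
    and do not depend on the basis, so they hold on the whole closure of the
    orbit ([closure_pinched]). In a commutative algebra L = R, and the trace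
    condition becomes 2 tr R_y = 0. This excludes every A_j having an element
    whose multiplication has nonzero trace. That leaves A_1, A_5, A_9 and A_10; in
    these S(x, y) = 3 x y, and the second condition excludes A_9 and A_10, where
    (e_2 e_3)(e_3 e_2)^T is nonzero while (e_3 e_3)(e_2 e_2)^T is zero.

    Conversely, A_1 and A_5 are limits at t = 0 of structures that are
    polynomial in t and lie in the orbit for t nonzero: for A_1, rescale the
    basis by t; for A_5, use the basis
      v = t (e_2 + (a + 1 + t eps) e_3),   f = t e_1 + e_3,   w = t e_3,
    in which f f = v + a t f and all other products of basis vectors vanish at
    t = 0. A polynomial vanishing on the orbit vanishes along the curve for t
    nonzero, hence at t = 0 ([curve_closure]). The limits are not in the orbit,
    since they are commutative and D_1 and D_2(alpha) are not. *)

Set Implicit Arguments.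
Unset Strict Implicit.
Unset Printing Implicit Defensive.

Import GRing.Theory Num.Theory.

Section Degenerations.
Local Open Scope classical_set_scope.
Local Open Scope ring_scope.

Variable R : realType.
Local Notation C := (complex R).
Local Notation V := 'cV[C]_3.
Local Notation structure := (structure R).
Local Notation M3 := 'M[C]_3.

(** * Multiplication operators, commutativity and orbits *)

Lemma mulmx_col_inj (A B : M3) : (forall x : V, A *m x = B *m x) -> A = B.
Proof.
by move=> AB; apply/matrixP => i j; move/matrixP/(_ i 0): (AB (delta_mx j 0));
  rewrite -!colE !mxE.
Qed.

Lemma outer_productE (u v : V) i j : (u *m v^T) i j = u i 0 * v j 0.
Proof. by rewrite mxE big_ord1 mxE. Qed.

Definition rmulmx (c : structure) (y : V) : M3 :=
  \matrix_(k, i) \sum_j c (i, j, k) * y j 0.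

Definition lmulmx (c : structure) (x : V) : M3 :=
  \matrix_(k, j) \sum_i c (i, j, k) * x i 0.

Lemma rmulmxE (c : structure) (x y : V) : rmulmx c y *m x = mul c x y.
Proof.
apply/colP => k; rewrite !mxE; apply: eq_bigr => i _.
by rewrite mxE mulr_suml; apply: eq_bigr => j _; rewrite mulrAC.
Qed.

Lemma lmulmxE (c : structure) (x y : V) : lmulmx c x *m y = mul c x y.
Proof.
apply/colP => k; rewrite !mxE exchange_big; apply: eq_bigr => j _.
by rewrite mxE mulr_suml.
Qed.

Lemma mul_delta (c : structure) i j k :
  mul c (delta_mx i 0) (delta_mx j 0) k 0 = c (i, j, k).
Proof.
rewrite -rmulmxE -colE !mxE (bigD1 j) //= mxE !eqxx mulr1 big1 ?addr0 // => l lj.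
by rewrite mxE (negPf lj) mulr0.
Qed.

Definition commutative_structure (c : structure) :=
  forall x y, mul c x y = mul c y x.

Lemma commutativeP (c : structure) :
  commutative_structure c <-> forall i j k, c (i, j, k) = c (j, i, k).
Proof.
split=> [cC i j k|cC x y]; first by rewrite -!mul_delta cC.
apply/colP => k; rewrite !mxE exchange_big; apply: eq_bigr => i _.
by apply: eq_bigr => j _; rewrite cC mulrAC.
Qed.

Lemma orbit_refl (c : structure) : orbit c c.
Proof.
by exists 1%:M; [exact: unitmx1 | move=> x y; rewrite invmx1 !mul1mx].
Qed.

Lemma orbit_sym (c d : structure) : orbit c d -> orbit d c.
Proof.
case=> g gU dE; exists (invmx g); first by rewrite unitmx_inv.
by move=> x y; rewrite invmxK dE !mulmxA mulVmx // !mul1mx.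
Qed.

Lemma orbit_commutative (c d : structure) :
  orbit c d -> commutative_structure c -> commutative_structure d.
Proof. by case=> g _ dE cC x y; rewrite !dE cC. Qed.

Lemma closure_boundary (b a : structure) :
    zariski_closure (orbit a) b -> commutative_structure b ->
  ~ commutative_structure a -> lies_in_boundary b a.
Proof.
move=> ab bC aNC; exists b; first exact: orbit_refl.
by split=> // /orbit_sym /orbit_commutative /(_ bC).
Qed.

(** * Polynomial functions and Zariski closures *)

Definition polynomial_function (f : structure -> C) :=
  exists p : {mpoly C[#|{: 'I_3 * 'I_3 * 'I_3}|]},
    forall c : structure, p.@[fun m => c (enum_val m)] = f c.

Lemma polynomial_const a : polynomial_function (fun=> a).
Proof. by exists a%:MP => c; rewrite mevalC. Qed.

Lemma polynomial_coord t : polynomial_function (fun c => c t).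
Proof. by exists 'X_(enum_rank t) => c; rewrite mevalXU enum_rankK. Qed.

Lemma polynomialD f g : polynomial_function f -> polynomial_function g ->
  polynomial_function (fun c => f c + g c).
Proof. by move=> [p pE] [q qE]; exists (p + q) => c; rewrite mevalD pE qE. Qed.

Lemma polynomialM f g : polynomial_function f -> polynomial_function g ->
  polynomial_function (fun c => f c * g c).
Proof. by move=> [p pE] [q qE]; exists (p * q) => c; rewrite mevalM pE qE. Qed.

Lemma polynomialB f g : polynomial_function f -> polynomial_function g ->
  polynomial_function (fun c => f c - g c).
Proof. by move=> [p pE] [q qE]; exists (p - q) => c; rewrite mevalB pE qE. Qed.

Lemma polynomial_sum (I : finType) (f : I -> structure -> C) :
    (forall i, polynomial_function (f i)) ->
  polynomial_function (fun c => \sum_i f i c).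
Proof.
move=> /fin_all_exists[p pE]; exists (\sum_i p i) => c.
by rewrite rmorph_sum; apply: eq_bigr => i _; exact: pE.
Qed.

Lemma polynomial_ext f g : f =1 g -> polynomial_function f ->
  polynomial_function g.
Proof. by move=> fg [p pE]; exists p => c; rewrite pE fg. Qed.

Lemma polynomial_mul (x y : V) k : polynomial_function (fun c => mul c x y k 0).
Proof.
pose f c := \sum_i \sum_j c (i, j, k) * x i 0 * y j 0.
apply: (@polynomial_ext f) => [c|]; first by rewrite mxE.
do 2![apply: polynomial_sum => ?].
by do 2![apply: polynomialM; last exact: polynomial_const];
  exact: polynomial_coord.
Qed.

Lemma polynomial_tr_rmul y : polynomial_function (fun c => \tr (rmulmx c y)).
Proof.
apply: polynomial_sum => k.
pose f c := \sum_j c (k, j, k) * y j 0.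
apply: (@polynomial_ext f) => [c|]; first by rewrite mxE.
apply: polynomial_sum => j.
by apply: polynomialM; [exact: polynomial_coord | exact: polynomial_const].
Qed.

Lemma polynomial_tr_lmul x : polynomial_function (fun c => \tr (lmulmx c x)).
Proof.
apply: polynomial_sum => k.
pose f c := \sum_i c (i, k, k) * x i 0.
apply: (@polynomial_ext f) => [c|]; first by rewrite mxE.
apply: polynomial_sum => i.
by apply: polynomialM; [exact: polynomial_coord | exact: polynomial_const].
Qed.

Lemma closure_eq (X : set structure) f g :
    polynomial_function f -> polynomial_function g ->
    (forall c, X c -> f c = g c) ->
  forall c, zariski_closure X c -> f c = g c.
Proof.
move=> pf pg fg c cX; apply/eqP; rewrite -subr_eq0; apply/eqP.
have [p pE] := polynomialB pf pg.
rewrite -pE; apply: (cX (zeros [set p])) => //.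
split; first by exists [set p].
by move=> d /fg fgd _ ->; rewrite pE fgd subrr.
Qed.

(** Composing an equation of [X] with the curve gives a polynomial in one
    variable that vanishes at every nonzero scalar, so it is zero. *)
Lemma curve_closure (X : set structure) (q : 'I_3 * 'I_3 * 'I_3 -> {poly C}) :
    (forall t, t != 0 -> X [ffun m => (q m).[t]]) ->
  zariski_closure X [ffun m => (q m).[0]].
Proof.
move=> qX _ [[I ->] XI] p Ip.
pose r := mmap (polyC : C -> {poly C}) (fun m => q (enum_val m)) p.
have rE t : r.[t] = p.@[fun m => [ffun m => (q m).[t]] (enum_val m)].
  rewrite /r /meval /mmap horner_sum; apply: eq_bigr => m _.
  rewrite hornerM hornerC /mmap1 horner_prod; congr (_ * _).
  by apply: eq_bigr => i _; rewrite horner_exp ffunE.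
rewrite -rE; have [->|r0] := eqVneq r 0; first by rewrite horner0.
pose s : seq C := [seq n.+1%:R | n <- iota 0 (size r)].
suff: (size s < size r)%N by rewrite size_map size_iota ltnn.
apply: max_poly_roots => //.
  apply/allP => _ /mapP[n _ ->]; apply/eqP; rewrite rE; apply: XI => //.
  by apply: qX; rewrite pnatr_eq0.
by rewrite map_inj_uniq ?iota_uniq // => m n /eqP; rewrite eqr_nat => /eqP[].
Qed.

(** * Products of the form a l(y) x + l(x) N y *)

Definition twisted (a : C) (l : 'rV[C]_3) (N : M3) : structure :=
  [ffun t => a * l 0 t.1.2 * (t.2 == t.1.1)%:R + l 0 t.1.1 * N t.2 t.1.2].

Lemma mul_twisted a l N x y :
  mul (twisted a l N) x y =
  (a * (l *m y) 0 0) *: x + (l *m x) 0 0 *: (N *m y).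
Proof.
apply/colP => k; rewrite !mxE.
transitivity (\sum_i (a * (\sum_j l 0 j * y j 0) * ((k == i)%:R * x i 0) +
   l 0 i * x i 0 * \sum_j N k j * y j 0)).
  apply: eq_bigr => i _; rewrite mulr_sumr mulr_suml mulr_sumr -big_split.
  by apply: eq_bigr => j _; rewrite ffunE /=; ring.
rewrite big_split /= -mulr_sumr -mulr_suml; congr (_ * _ + _ * _).
rewrite (bigD1 k) //= eqxx mul1r big1 ?addr0 // => i /negPf.
by rewrite eq_sym => ->; rewrite mul0r.
Qed.

(** In the basis formed by the columns of [h], the form [l] and the endomorphism
    [N] become [l h] and [h^-1 N h]. The factor [t] can be moved from the form to
    the scalar and the endomorphism: here [k] and [M] are t^-1 [l h] and
    t [h^-1 N h]. This is what lets [k] and [M] have a limit when [l h] tends to 0. *)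
Lemma orbit_twisted a l N t k M h : h \in unitmx ->
    l *m h = t *: k -> t *: (N *m h) = h *m M ->
  orbit (twisted a l N) (twisted (t * a) k M).
Proof.
move=> hU lh Nh; exists (invmx h); first by rewrite unitmx_inv.
move=> x y; rewrite invmxK; apply: (can_inj (mulKmx hU)).
rewrite mulKVmx // !mul_twisted mulmxDr -!scalemxAr !mulmxA -Nh lh.
by rewrite -!scalemxAl !mxE scalerA; congr (_ *: _ + _ *: _); ring.
Qed.

(** The structures of [orbit_twisted] for [h t] depend polynomially on [t] as soon
    as t [h^-1 N h] does, although [h t] may be singular at 0. *)
Lemma twisted_degeneration a l N k (M : 'M[{poly C}]_3) (h : C -> M3) :
    (forall t, t != 0 ->
       [/\ h t \in unitmx, l *m h t = t *: k &
           t *: (N *m h t) = h t *m map_mx (horner^~ t) M]) ->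
  zariski_closure (orbit (twisted a l N)) (twisted 0 k (map_mx (horner^~ 0) M)).
Proof.
move=> hP.
pose q (m : 'I_3 * 'I_3 * 'I_3) : {poly C} :=
  'X * a%:P * (k 0 m.1.2)%:P * (m.2 == m.1.1)%:R%:P + (k 0 m.1.1)%:P * M m.2 m.1.2.
have qE t : [ffun m => (q m).[t]] = twisted (t * a) k (map_mx (horner^~ t) M).
  by apply/ffunP => m; rewrite !ffunE !mxE /q !(hornerE, hornerX).
have <- : [ffun m => (q m).[0]] = twisted 0 k (map_mx (horner^~ 0) M).
  by rewrite qE mul0r.
apply: curve_closure => t /hP[hU lh Nh].
by rewrite qE; exact: orbit_twisted lh Nh.
Qed.

(** * A closed condition satisfied by the degenerations *)

(** For [twisted a l N] with [l N = 0] this is 3 l(x) N y: subtracting the trace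
    of the right multiplication leaves its part of rank one. *)
Definition deviation (c : structure) (x y : V) : V :=
  3%:R *: mul c x y - \tr (rmulmx c y) *: x.

(** The second condition says that [deviation c x y] is the product of a linear
    form in [x] and a vector depending on [y], in a form polynomial in [c]. *)
Definition pinched (a : C) (c : structure) :=
  (forall y, (3%:R * a + 2%:R) * \tr (rmulmx c y) =
             3%:R * a * \tr (lmulmx c y)) /\
  (forall x x' y y', deviation c x y *m (deviation c x' y')^T =
                     deviation c x' y *m (deviation c x y')^T).

Lemma orbit_pinched a (c d : structure) : orbit c d -> pinched a c -> pinched a d.
Proof.
case=> g gU dE [trc devc].
have rE y : rmulmx d y = g *m rmulmx c (invmx g *m y) *m invmx g.
  by apply: mulmx_col_inj => x; rewrite rmulmxE dE -!mulmxA rmulmxE.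
have lE x : lmulmx d x = g *m lmulmx c (invmx g *m x) *m invmx g.
  by apply: mulmx_col_inj => y; rewrite lmulmxE dE -!mulmxA lmulmxE.
have trJ (B : M3) : \tr (g *m B *m invmx g) = \tr B.
  by rewrite mxtrace_mulC mulmxA mulVmx // mul1mx.
have devE x y : deviation d x y = g *m deviation c (invmx g *m x) (invmx g *m y).
  by rewrite /deviation mulmxBr -!scalemxAr mulKVmx // dE rE trJ.
split=> [y|x x' y y']; first by rewrite rE lE !trJ trc.
have outerE (u v : V) : g *m u *m (g *m v)^T = g *m (u *m v^T) *m g^T.
  by rewrite trmx_mul !mulmxA.
(* As variables, the deviations cannot be unfolded by the rewriting below. *)
move: (deviation c) (deviation d) devc devE => devc' devd devc devE.
by rewrite !devE !outerE devc.
Qed.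

Lemma closure_pinched a (X : set structure) :
    (forall c, X c -> pinched a c) ->
  forall c, zariski_closure X c -> pinched a c.
Proof.
move=> Xp c cX.
have pdev x y k : polynomial_function (fun c => deviation c x y k 0).
  pose f c := 3%:R * mul c x y k 0 - \tr (rmulmx c y) * x k 0.
  apply: (@polynomial_ext f) => [d|].
    rewrite /f /deviation [RHS]mxE; congr (_ + _); first by rewrite [RHS]mxE.
    by rewrite [RHS]mxE; congr (- _); rewrite [RHS]mxE.
  apply: polynomialB; apply: polynomialM.
  - exact: polynomial_const.
  - exact: polynomial_mul.
  - exact: polynomial_tr_rmul.
  - exact: polynomial_const.
split=> [y|x x' y y'].
  apply: (closure_eq (X := X)
    (f := fun c => (3%:R * a + 2%:R) * \tr (rmulmx c y))
    (g := fun c => 3%:R * a * \tr (lmulmx c y))) cX.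
  - by apply: polynomialM; [exact: polynomial_const|exact: polynomial_tr_rmul].
  - by apply: polynomialM; [exact: polynomial_const|exact: polynomial_tr_lmul].
  - by move=> d /Xp[].
apply/matrixP => i j; rewrite !outer_productE.
apply: (closure_eq (X := X)
  (f := fun c => deviation c x y i 0 * deviation c x' y' j 0)
  (g := fun c => deviation c x' y i 0 * deviation c x y' j 0)) cX;
  try exact: polynomialM.
move=> d /Xp[_ /(_ x x' y y')] /matrixP/(_ i j).
by rewrite !outer_productE.
Qed.

Lemma twisted_pinched a l N : l *m N = 0 -> \tr N = 2%:R * (a + 1) ->
  pinched a (twisted a l N).
Proof.
move=> lN trN.
have mulmx_dot (u v : V) : u *m (l *m v) = (l *m v) 0 0 *: u.
  by rewrite {1}[l *m v]mx11_scalar mul_mx_scalar.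
have rE y : rmulmx (twisted a l N) y = (a * (l *m y) 0 0)%:M + N *m y *m l.
  apply: mulmx_col_inj => x; rewrite rmulmxE mul_twisted mulmxDl mul_scalar_mx.
  by rewrite -(mulmxA _ l) mulmx_dot.
have lE x : lmulmx (twisted a l N) x = x *m (a *: l) + (l *m x) 0 0 *: N.
  apply: mulmx_col_inj => y; rewrite lmulmxE mul_twisted mulmxDl -!mulmxA.
  by rewrite -!scalemxAl -scalemxAr mulmx_dot scalerA.
have trr y : \tr (rmulmx (twisted a l N) y) = 3%:R * a * (l *m y) 0 0.
  rewrite rE mxtraceD mxtrace_scalar mxtrace_mulC mulmxA lN mul0mx mxtrace0.
  by rewrite addr0 -[LHS]mulr_natl mulrA.
have trl x : \tr (lmulmx (twisted a l N) x) = (3%:R * a + 2%:R) * (l *m x) 0 0.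
  rewrite lE mxtraceD mxtrace_mulC -scalemxAl !mxtraceZ trN.
  by rewrite /mxtrace big_ord1; ring.
split=> [y|x x' y y']; first by rewrite trr trl; ring.
have devE u v : deviation (twisted a l N) u v =
    (3%:R * (l *m u) 0 0) *: (N *m v).
  rewrite /deviation mul_twisted trr scalerDr !scalerA mulrA addrAC subrr.
  by rewrite add0r.
have outerZ s t (u v : V) : (s *: u) *m (t *: v)^T = (s * t) *: (u *m v^T).
  by rewrite linearZ /= -scalemxAl -scalemxAr scalerA.
by rewrite !devE !outerZ mulrC.
Qed.

(** Left and right multiplications coincide, and the coefficients of the two
    sides of the trace condition differ by 2. *)
Lemma commutative_pinched_tr a c : commutative_structure c -> pinched a c ->
  forall y, \tr (rmulmx c y) = 0.
Proof.
move=> cC [trc _] y; move: (trc y).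
have -> : lmulmx c y = rmulmx c y.
  by apply: mulmx_col_inj => x; rewrite lmulmxE rmulmxE cC.
move/eqP; rewrite -subr_eq0 -mulrBl addrAC subrr add0r mulf_eq0 pnatr_eq0 /=.
by move/eqP.
Qed.

Lemma commutative_pinched_coord a c : commutative_structure c -> pinched a c ->
  forall j, \sum_i c (i, j, i) = 0.
Proof.
move=> cC cp j; rewrite -[RHS](commutative_pinched_tr cC cp (delta_mx j 0)).
apply: eq_bigr => i _; rewrite mxE (bigD1 j) //= mxE !eqxx mulr1 big1 ?addr0 //.
by move=> k kj; rewrite mxE (negPf kj) mulr0.
Qed.

Lemma commutative_pinched_minor a c : commutative_structure c -> pinched a c ->
  forall i i' j j' k k',
    c (i, j, k) * c (i', j', k') = c (i', j, k) * c (i, j', k').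
Proof.
move=> cC cp i i' j j' k k'.
have devE i1 j1 k1 :
    deviation c (delta_mx i1 0) (delta_mx j1 0) k1 0 = 3%:R * c (i1, j1, k1).
  rewrite /deviation (commutative_pinched_tr cC cp) scale0r subr0 mxE.
  by rewrite mul_delta.
case: cp => _; move: (deviation c) devE => dev devE.
move/(_ (delta_mx i 0) (delta_mx i' 0) (delta_mx j 0) (delta_mx j' 0)).
move/matrixP/(_ k k'); rewrite !outer_productE !devE mulrACA [RHS]mulrACA.
by move/(mulfI _); apply; rewrite mulf_neq0 ?pnatr_eq0.
Qed.

(** * The algebras D_1, D_2(alpha) and their degenerations *)

Definition mx3 (S : nzRingType) (s : seq (seq S)) : 'M[S]_3 :=
  \matrix_(i, j) (nth [::] s i)`_j.

Definition generator_mx (a eps : C) : M3 :=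
  mx3 [:: [:: 0; 0; 0]; [:: 0; a + 1; 1]; [:: eps; 0; a + 1]].

Definition Dfamily (a eps : C) : structure :=
  twisted a (delta_mx 0 0) (generator_mx a eps).

Ltac ord3_cases i := case: i => [[|[|[|//]]] ?].

Lemma D1_Dfamily : D1 R = Dfamily (-1) 1.
Proof.
apply/ffunP => -[[i j] k]; rewrite !ffunE /=.
by ord3_cases i; ord3_cases j; ord3_cases k; rewrite /e ?mxE /= ?mxE /=; ring.
Qed.

Lemma D2_Dfamily a : D2 a = Dfamily a 0.
Proof.
apply/ffunP => -[[i j] k]; rewrite !ffunE /=.
by ord3_cases i; ord3_cases j; ord3_cases k; rewrite /e ?mxE /= ?mxE /=; ring.
Qed.

Lemma Dfamily_not_commutative a eps : ~ commutative_structure (Dfamily a eps).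
Proof.
move/commutativeP => /(_ 0 (lift 0 (lift 0 0)) (lift 0 0)) /eqP.
by rewrite !ffunE !mxE /= !(mulr0, mul0r, mulr1, add0r) oner_eq0.
Qed.

Lemma Dfamily_pinched a eps : pinched a (Dfamily a eps).
Proof.
apply: twisted_pinched.
  by apply/rowP => j; rewrite -rowE !mxE; ord3_cases j.
by rewrite /mxtrace !big_ord_recl big_ord0 !mxE /=; ring.
Qed.

(** The product is multiplied by [t] when all the basis vectors are. *)
Lemma Dfamily_degenerates_A1 a eps :
  zariski_closure (orbit (Dfamily a eps)) (A1 R).
Proof.
pose l : 'rV[C]_3 := delta_mx 0 0; pose N := generator_mx a eps.
pose M : 'M[{poly C}]_3 := 'X *: map_mx polyC N.
have -> : A1 R = twisted 0 l (map_mx (horner^~ 0) M).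
  have -> : map_mx (horner^~ 0) M = 0.
    by apply/matrixP => i j; rewrite !mxE hornerM hornerX mul0r.
  by apply/ffunP => m; rewrite !ffunE !mxE !(mul0r, mulr0, addr0).
apply: (@twisted_degeneration _ _ _ _ M (fun t => t%:M)) => t t0; split.
- by rewrite unitmxE det_scalar unitfE expf_neq0.
- by rewrite mul_mx_scalar.
- rewrite mul_mx_scalar mul_scalar_mx; congr (_ *: _).
  by apply/matrixP => i j; rewrite !mxE hornerM hornerX hornerC.
Qed.

(** Evaluation only: the simplifications of [hornerE] leave terms that [ring]
    does not recognize. *)
Definition horner_rules (S : comNzRingType) :=
  (@hornerD S, @hornerM S, @hornerN S, @horner_exp S, @hornerX S, @hornerC S,
   @horner0 S).

(** The columns of [h t] are v = t (e_2 + (b + t eps) e_3), f = t e_1 + e_3 and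
    w = t e_3, where b = a + 1. They are in this order because f f = v in the
    limit, whereas e_2 e_2 = e_1 in A_5. The columns of [M] are t N v, t N f and
    t N w in the basis (v, f, w). *)
Lemma Dfamily_degenerates_A5 a eps :
  zariski_closure (orbit (Dfamily a eps)) (A5 R).
Proof.
pose b := a + 1.
pose M : 'M[{poly C}]_3 := mx3
  [:: [:: 'X * ((2%:R * b)%:P + 'X * eps%:P); 1%:P; 'X];
      [:: 0; 0; 0];
      [:: - ('X * (b%:P + 'X * eps%:P) ^+ 2); 0; - ('X ^+ 2 * eps%:P)]].
pose h t : M3 := mx3
  [:: [:: 0; t; 0]; [:: t; 0; 0]; [:: t * (b + t * eps); 1; t]].
(* The inverse of [h t] for [t] nonzero. *)
pose h' t : M3 := mx3
  [:: [:: 0; t^-1; 0]; [:: t^-1; 0; 0];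
      [:: - t^-1 ^+ 2; - (t^-1 * (b + t * eps)); t^-1]].
have -> : A5 R = twisted 0 (delta_mx 0 (lift 0 0)) (map_mx (horner^~ 0) M).
  have -> : map_mx (horner^~ 0) M = delta_mx 0 (lift 0 0).
    apply/matrixP => i j; rewrite !mxE.
    by ord3_cases i; ord3_cases j; rewrite /= ?horner_rules; ring.
  apply/ffunP => -[[i j] k]; rewrite !ffunE /=.
  by ord3_cases i; ord3_cases j; ord3_cases k; rewrite /e ?mxE /= ?mxE /=; ring.
apply: (@twisted_degeneration _ _ _ _ M h) => t t0; split.
- suff /mulmx1_unit[] : h t *m h' t = 1%:M by [].
  apply/matrixP => i j; rewrite !mxE !big_ord_recl !big_ord0 !mxE.
  by ord3_cases i; ord3_cases j; rewrite /=; field.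
- by apply/rowP => j; rewrite -rowE !mxE; ord3_cases j; rewrite /=; ring.
- apply/matrixP => i j; rewrite !mxE !big_ord_recl !big_ord0 !mxE.
  by ord3_cases i; ord3_cases j; rewrite /= ?horner_rules /b; ring.
Qed.

Lemma A_commutative j : commutative_structure (A R j).
Proof.
apply/commutativeP.
by case: j => [|[|[|[|[|[|[|[|[|[|[|[|[|?]]]]]]]]]]]]] i j k;
  rewrite !ffunE /=; ord3_cases i; ord3_cases j.
Qed.

(** The trace of multiplication by e_2 or e_3 is nonzero unless [j] is 1, 5, 9 or
    10. In A_9 and A_10, e_2 e_3 = e_3 e_2 = e_1 whereas e_3 e_3 and e_2 e_2 do not
    both have an e_1 component. *)
Lemma pinched_A a j : (1 <= j <= 12)%N -> pinched a (A R j) ->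
  j \in [:: 1; 5]%N.
Proof.
move=> hj Ap.
have /(_ _)/eqP tr0 := commutative_pinched_coord (A_commutative j) Ap.
have minor0 := commutative_pinched_minor (A_commutative j) Ap.
pose o1 : 'I_3 := 0; pose o2 : 'I_3 := lift 0 0.
pose o3 : 'I_3 := lift 0 (lift 0 0).
have tr2 := tr0 o2; have {tr0}tr3 := tr0 o3.
(* Compare the e_1 components of (e_2 e_3)(e_3 e_2) and (e_3 e_3)(e_2 e_2). *)
move/eqP: (minor0 o2 o3 o3 o2 o1 o1) => {minor0 Ap}.
move: tr2 tr3 hj; rewrite !big_ord_recl !big_ord0.
case: j => [|[|[|[|[|[|[|[|[|[|[|[|[|?]]]]]]]]]]]]] //=;
  rewrite !ffunE /= /e !mxE /= ?simpE -?(natrD _ 1 1) -?(natrD _ 1 2)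
    ?pnatr_eq0 ?oner_eq0 //.
Qed.

Lemma boundary_Dfamily a eps j : (1 <= j <= 12)%N ->
  lies_in_boundary (A R j) (Dfamily a eps) <-> j \in [:: 1; 5]%N.
Proof.
move=> hj; split=> [[d Ad [dcl _]]|].
  apply: (@pinched_A a) => //; apply: orbit_pinched (orbit_sym Ad) _.
  apply: closure_pinched dcl => c /orbit_pinched; apply.
  exact: Dfamily_pinched.
rewrite !inE => /orP[] /eqP ->; apply: closure_boundary;
  (exact: Dfamily_not_commutative || exact: (A_commutative 1)
   || exact: (A_commutative 5) || exact: Dfamily_degenerates_A1
   || exact: Dfamily_degenerates_A5).
Qed.

End Degenerations.

Theorem proposition4p13 (R : realType) (j : nat) (hj : 1 <= j <= 12) :
  (lies_in_boundary (A R j) (D1 R) <-> j \in [:: 1; 5]) /\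
  (forall alpha : complex R,
     lies_in_boundary (A R j) (D2 alpha) <-> j \in [:: 1; 5]).
Proof.
by split=> [|alpha]; rewrite ?D1_Dfamily ?D2_Dfamily; exact: boundary_Dfamily.
Qed.
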